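(* Let $\mathcal M_3$ be the algebraic matroid of the third Heron variety $X_3\subseteq\mathbb C^{11}$, with ground set $E=\{S\subseteq\{1,2,3,4\} : |S|\ge 2\}$. Under the action of $\mathfrak S_4$ on the vertex labels, the $6$-element subsets of $E$ form $35$ orbits, of which $28$ consist of bases of $\mathcal M_3$ and $7$ consist of non-bases. Representatives of the $28$ orbits of bases are \begin{align*} B_1&=\{12,13,14,23,24,34\}, & B_3&=\{12,13,14,24,34,123\},\\ B_4&=\{12,13,14,23,24,1234\}, & B_7&=\{12,13,14,34,123,124\},\\ B_8&=\{12,13,14,24,123,234\}, & B_9&=\{12,13,24,34,123,124\},\\ B_{11}&=\{12,13,123,124,134,234\}, & B_{12}&=\{12,34,123,124,134,234\},\\ B_{14}&=\{12,13,14,24,123,1234\}, & B_{15}&=\{12,14,24,34,123,1234\},\\ B_{16}&=\{12,13,24,34,123,1234\}, & B_{17}&=\{12,123,124,134,234,1234\},\\ B_{18}&=\{12,13,14,123,124,134\}, & B_{19}&=\{12,13,14,123,124,234\},\\ B_{21}&=\{12,14,24,123,134,234\}, & B_{22}&=\{12,13,24,123,124,134\},\\ B_{23}&=\{12,13,34,123,124,234\}, & B_{24}&=\{12,13,14,123,124,1234\},\\ B_{25}&=\{12,13,14,123,234,1234\}, & B_{27}&=\{12,14,24,123,134,1234\},\\ B_{28}&=\{12,13,24,123,124,1234\}, & B_{29}&=\{12,13,34,123,124,1234\},\\ B_{30}&=\{12,13,24,123,234,1234\}, & B_{31}&=\{12,24,34,123,134,1234\},\\ B_{32}&=\{12,13,123,124,134,1234\},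 & B_{33}&=\{12,13,123,124,234,1234\},\\ B_{34}&=\{12,34,123,124,134,1234\}, & B_{35}&=\{12,14,123,134,234,1234\}, \end{align*} and representatives of the $7$ orbits of non-bases of size $6$ are \begin{align*} B_2&=\{12,13,14,23,24,123\}, & B_5&=\{12,13,14,23,123,124\},\\ B_6&=\{12,13,23,34,123,124\}, & B_{10}&=\{12,13,24,34,123,234\},\\ B_{13}&=\{12,13,14,23,123,1234\}, & B_{20}&=\{12,13,23,123,124,134\},\\ B_{26}&=\{12,13,23,123,124,1234\}. \end{align*} Moreover, up to the $\mathfrak S_4$-action there are exactly two orbits of circuits of $\mathcal M_3$ of size $6$ or smaller, with representatives $$C_1=\{12,13,23,123\}\qquad\text{and}\qquad C_2=\{12,13,24,34,123,234\}.$$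
   Context: A subset such as $\{1,2,3\}$ is abbreviated $123$. For $n\ge 1$ put $e(n)=\binom{n+1}{2}$ and $N(n)=2^{n+1}-(n+1)-1$, the number of subsets $S\subseteq[n+1]=\{1,\dots,n+1\}$ with $|S|\ge 2$ (these index the positive-dimensional faces of an $n$-simplex). For variables $x_{ij}=x_{ji}$ ($1\le i<j\le n+1$) and $S=\{s_1<\dots<s_{m+1}\}\subseteq[n+1]$ with $m\ge1$, define $$x_S=\frac{(-1)^{m+1}}{(m!)^2 2^m}\det\begin{pmatrix}0&\mathbf 1^T\\ \mathbf 1&D_S\end{pmatrix},$$ where $D_S$ is the symmetric $(m+1)\times(m+1)$ matrix with zero diagonal and $(a,b)$ entry $x_{s_as_b}$ for $a\neq b$ (Cayley–Menger determinant; for $|S|=2$ this is just $x_{ij}$). This gives the polynomial map $\varphi_n:\mathbb C^{e(n)}\to\mathbb C^{N(n)}$, $(x_{ij})\mapsto(x_S)_{S\subseteq[n+1],|S|\ge2}$. The $n$-th Heron variety $X_n\subseteq\mathbb C^{N(n)}$ is the Zariski closure of the image of $\varphi_n$; it is irreducible of dimension $e(n)$. For an irreducible affine variety $X\subseteq\mathbb C^N$, the algebraic matroid $\mathcal M(X)$ has ground set the set of coordinate indices; its bases are the subsets $B$ for which the coordinate projection $\pi_B:X\to\mathbb C^{|B|}_B$, $\mathbf x\mapsto(x_b)_{b\in B}$, is finite-to-one (on generic fibres) and dominant. Subsets of bases are independent; other subsets are dependent; circuits are the minimal dependent sets. $\mathcal M_n=\mathcal M(X_n)$ has ground set $\{S\subseteq[n+1]:|S|\ge2\}$,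 and $\mathfrak S_{n+1}$ acts on this ground set by permuting $[n+1]$. *)

(* Defs.v *)
From mathcomp Require Import all_boot all_order all_algebra all_fingroup.
From mathcomp Require Import mpoly.
From mathcomp Require Import complex.
From mathcomp Require Import classical_sets cardinality reals.

Set Implicit Arguments.
Unset Strict Implicit.
Unset Printing Implicit Defensive.

Import GRing.Theory.
Local Open Scope ring_scope.

(* Affine space K^I with coordinates indexed by a finite type I is
   {ffun I -> K}; the k-th variable of a polynomial stands for the
   coordinate enum_val k. *)

Definition poly_eval (K : fieldType) (I : finType)
    (p : {mpoly K[#|I|]}) (x : {ffun I -> K}) : K :=
  p.@[fun k : 'I_#|I| => x (enum_val k)].

Definition vanishing_ideal (K : fieldType) (I : finType)
    (A : set {ffun I -> K}) : set {mpoly K[#|I|]} :=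
  [set p | forall x, A x -> poly_eval p x = 0]%classic.

Definition zero_locus (K : fieldType) (I : finType)
    (J : set {mpoly K[#|I|]}) : set {ffun I -> K} :=
  [set x | forall p, J p -> poly_eval p x = 0]%classic.

Definition zariski_closure (K : fieldType) (I : finType)
    (A : set {ffun I -> K}) : set {ffun I -> K} :=
  zero_locus (vanishing_ideal A).

Definition zariski_open (K : fieldType) (I : finType)
    (U : set {ffun I -> K}) : Prop :=
  exists J : set {mpoly K[#|I|]}, (~` U = zero_locus J)%classic.

Definition coord_proj (K : fieldType) (I : finType) (B : {set I})
    (x : {ffun I -> K}) : {ffun {i : I | i \in B} -> K} :=
  [ffun b => x (val b)].

Definition dominant_on (K : fieldType) (I J : finType)
    (X : set {ffun I -> K}) (f : {ffun I -> K} -> {ffun J -> K}) : Prop :=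
  zariski_closure (f @` X)%classic = setT%classic.

Definition generically_finite_on (K : fieldType) (I J : finType)
    (X : set {ffun I -> K}) (f : {ffun I -> K} -> {ffun J -> K}) : Prop :=
  exists U : set {ffun J -> K},
    [/\ zariski_open U, (U !=set0)%classic &
        forall y, U y -> finite_set (X `&` f @^-1` [set y])%classic].

(* The algebraic matroid of X, for X an irreducible affine variety. *)

Definition matroid_basis (K : fieldType) (I : finType)
    (X : set {ffun I -> K}) (B : {set I}) : Prop :=
  generically_finite_on X (coord_proj B) /\ dominant_on X (coord_proj B).

Definition matroid_independent (K : fieldType) (I : finType)
    (X : set {ffun I -> K}) (A : {set I}) : Prop :=
  exists2 B : {set I}, matroid_basis X B & A \subset B.

Definition matroid_dependent (K : fieldType) (I : finType)
    (X : set {ffun I -> K}) (A : {set I}) : Prop :=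
  ~ matroid_independent X A.

Definition matroid_circuit (K : fieldType) (I : finType)
    (X : set {ffun I -> K}) (A : {set I}) : Prop :=
  matroid_dependent X A /\
  forall D : {set I}, D \proper A -> ~ matroid_dependent X D.

(* The vertices 1, ..., n+1 of the n-simplex are 0, ..., n here. *)

Definition edge (n : nat) := {e : {set 'I_n.+1} | #|e| == 2%N}.
Definition face (n : nat) := {S : {set 'I_n.+1} | (2 <= #|S|)%N}.

(* For i = j, [set i; j] is not an edge and the value is 0. *)
Definition sq_dist (K : fieldType) (n : nat) (x : {ffun edge n -> K})
    (i j : 'I_n.+1) : K :=
  if insub [set i; j] is Some e then x e else 0.

Definition dist_mx (K : fieldType) (n : nat) (x : {ffun edge n -> K})
    (S : {set 'I_n.+1}) : 'M[K]_#|S| :=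
  \matrix_(a, b) sq_dist x (enum_val a) (enum_val b).

Definition cayley_menger (K : fieldType) (n : nat) (x : {ffun edge n -> K})
    (S : {set 'I_n.+1}) : K :=
  let m := #|S|.-1 in
  (-1) ^+ m.+1 / ((m`!)%:R ^+ 2 * 2 ^+ m) *
  \det (block_mx (0 : 'M_1) (const_mx 1) (const_mx 1) (dist_mx x S)).

Definition heron_map (K : fieldType) (n : nat) (x : {ffun edge n -> K}) :
    {ffun face n -> K} :=
  [ffun S => cayley_menger x (val S)].

Definition heron_variety (K : fieldType) (n : nat) :
    set {ffun face n -> K} :=
  zariski_closure (range (@heron_map K n)).

Arguments heron_variety K n : clear implicits.

Lemma face_perm_subproof n (S : face n) (s : {perm 'I_n.+1}) :
  (2 <= #|s @: val S|)%N.
Proof. by rewrite card_imset ?(valP S) //; exact: perm_inj. Qed.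

Definition face_perm n (S : face n) (s : {perm 'I_n.+1}) : face n :=
  Sub (s @: val S) (face_perm_subproof S s).

Lemma face_perm1 n (S : face n) : face_perm S 1%g = S.
Proof.
apply: val_inj; rewrite SubK -[RHS]imset_id.
by apply: eq_imset => i; rewrite perm1.
Qed.

Lemma face_permM n (S : face n) : act_morph (@face_perm n) S.
Proof.
move=> s t; apply: val_inj; rewrite !SubK -imset_comp.
by apply: eq_imset => i; rewrite permM.
Qed.

Definition face_action n : {action {perm 'I_n.+1} &-> face n} :=
  TotalAction (@face_perm1 n) (@face_permM n).

Definition face_orbit n (B : {set face n}) : {set {set face n}} :=
  orbit (face_action n)^* [set: {perm 'I_n.+1}] B.

(* reps lists exactly one representative of every orbit all of whose members
   satisfy P. *)
Definition orbit_representatives n (P : {set face n} -> Prop)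
    (reps : seq {set face n}) : Prop :=
  uniq [seq face_orbit B | B <- reps] /\
  forall O : {set {set face n}},
    O \in [seq face_orbit B | B <- reps] <->
    (exists A, O = face_orbit A) /\ (forall A, A \in O -> P A).

(* The subset of the vertices abbreviated by the decimal digits of k
   (at most four of them), as in 123 for {1, 2, 3}. *)
Definition digits4 (k : nat) : seq nat :=
  [:: k %% 10; k %/ 10 %% 10; k %/ 100 %% 10; k %/ 1000 %% 10]%N.

Definition labelled (k : nat) : {set 'I_4} :=
  [set i : 'I_4 | i.+1 \in digits4 k].

Definition faces (ks : seq nat) : {set face 3} :=
  [set S : face 3 | val S \in [seq labelled k | k <- ks]].

Definition basis_reps : seq {set face 3} :=
  [seq faces ks | ks <-
   [:: [:: 12; 13; 14; 23; 24; 34];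
       [:: 12; 13; 14; 24; 34; 123];
       [:: 12; 13; 14; 23; 24; 1234];
       [:: 12; 13; 14; 34; 123; 124];
       [:: 12; 13; 14; 24; 123; 234];
       [:: 12; 13; 24; 34; 123; 124];
       [:: 12; 13; 123; 124; 134; 234];
       [:: 12; 34; 123; 124; 134; 234];
       [:: 12; 13; 14; 24; 123; 1234];
       [:: 12; 14; 24; 34; 123; 1234];
       [:: 12; 13; 24; 34; 123; 1234];
       [:: 12; 123; 124; 134; 234; 1234];
       [:: 12; 13; 14; 123; 124; 134];
       [:: 12; 13; 14; 123; 124; 234];
       [:: 12; 14; 24; 123; 134; 234];
       [:: 12; 13; 24; 123; 124; 134];
       [:: 12; 13; 34; 123; 124; 234];
       [:: 12; 13; 14; 123; 124; 1234];
       [:: 12; 13; 14; 123; 234; 1234];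
       [:: 12; 14; 24; 123; 134; 1234];
       [:: 12; 13; 24; 123; 124; 1234];
       [:: 12; 13; 34; 123; 124; 1234];
       [:: 12; 13; 24; 123; 234; 1234];
       [:: 12; 24; 34; 123; 134; 1234];
       [:: 12; 13; 123; 124; 134; 1234];
       [:: 12; 13; 123; 124; 234; 1234];
       [:: 12; 34; 123; 124; 134; 1234];
       [:: 12; 14; 123; 134; 234; 1234]]%N].

Definition nonbasis_reps : seq {set face 3} :=
  [seq faces ks | ks <-
   [:: [:: 12; 13; 14; 23; 24; 123];
       [:: 12; 13; 14; 23; 123; 124];
       [:: 12; 13; 23; 34; 123; 124];
       [:: 12; 13; 24; 34; 123; 234];
       [:: 12; 13; 14; 23; 123; 1234];
       [:: 12; 13; 23; 123; 124; 134];
       [:: 12; 13; 23; 123; 124; 1234]]%N].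

Definition circuit_reps : seq {set face 3} :=
  [seq faces ks | ks <-
   [:: [:: 12; 13; 23; 123];
       [:: 12; 13; 24; 34; 123; 234]]%N].

(* Main.v *)
(** Since all edges are faces, the Heron variety is the graph of a polynomial map,
    hence equal to the image of the Heron map.  Comparing the number of monomials
    with the dimension of the space containing them shows that each squared edge
    length is algebraic over any six Heron coordinates, so a projection to six
    coordinates is always generically finite and only dominance matters.

    Six coordinates are independent as soon as their Jacobian is invertible at one
    point: arcs in the image then leave this point in every direction, and a
    polynomial vanishing on them has vanishing lowest-degree form.  One integer
    point serves for all hexads that contain no translate of [C1] or [C2].
    Conversely Heron's formula is a relation on [C1], and eliminating the common
    edge from two such formulas gives a relation on [C2].  The orbits are then
    sorted out by computation on lists of face codes. *)

From Corelib Require Import BinNums.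
Require Import Defs.
From mathcomp Require Import all_boot all_order all_algebra all_fingroup.
From mathcomp Require Import mpoly.
From mathcomp Require Import ssrZ ring complex.
From mathcomp Require Import boolp classical_sets cardinality reals.

Set Implicit Arguments.
Unset Strict Implicit.
Unset Printing Implicit Defensive.

Import GRing.Theory Num.Theory.
Local Open Scope ring_scope.

(** * Polynomials vanishing on arcs *)

Lemma poly_vanish (K : numFieldType) (p : {poly K}) :
  (forall t, p.[t] = 0) -> p = 0.
Proof.
move=> p0; apply/eqP/negPn/negP => pn0.
have := @max_poly_roots _ p [seq k%:R | k <- iota 0 (size p)] pn0.
rewrite size_map size_iota ltnn => H.
suff: false by []; apply: H.
  by apply/allP => x _; rewrite /root p0.
rewrite map_inj_uniq ?iota_uniq // => a b /eqP.
by rewrite eqr_nat => /eqP.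
Qed.

(** Induction on the number of variables: [muni] reads [p] as a polynomial in its last variable.
    Specialising the other variables to [v] gives a univariate polynomial that is zero everywhere,
    so every coefficient vanishes at [v]. *)
Lemma mpoly_vanish (K : numFieldType) n (p : {mpoly K[n]}) :
  (forall v, p.@[v] = 0) -> p = 0.
Proof.
elim: n p => [|n IHn] p p0.
  have sp : (msize p <= 1)%N.
    rewrite msizeE big_seq; elim/big_rec: _ => // m x _ xle.
    by rewrite geq_max xle andbT mdegE big_ord0.
  by have := p0 (fun=> 0); rewrite (msize1_polyC sp) mevalC => ->; rewrite mpolyC0.
(* The coefficients of [muni p] are those of [p] at monomials extended by the exponent [k] of the
   last variable; this carries [muni p = 0] back to [p]. *)
have muni_coef k m : ((muni p)`_k)@_m =
    p@_[multinom (if unlift ord_max i is Some j then m j else k) | i < n.+1].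
  rewrite muniE coef_sum raddf_sum /=.
  set m' := [multinom _ | _ < _].
  have [m'p|m'p] := boolP (m' \in msupp p); last first.
    rewrite (memN_msupp_eq0 m'p) big_seq big1 // => m1 m1p.
    rewrite coefZ coefXn.
    case: eqP => [km|_]; last by rewrite mulr0 mcoeff0.
    rewrite mulr1 mcoeffZ mcoeffX; case: eqP => [Em|_]; last by rewrite mulr0.
    case/negP: m'p; suff -> : m' = m1 by [].
    apply/mnmP => i; rewrite mnmE; case: unliftP => [j|] ->; last by [].
    rewrite -Em mnmE; congr (m1 _); apply: val_inj => /=.
    by rewrite /bump leqNgt ltn_ord.
  rewrite (bigD1_seq m') ?msupp_uniq //= big1 ?addr0 => [|m1 m1m'].
    rewrite coefZ coefXn mnmE unlift_none eqxx mulr1 mcoeffZ mcoeffX.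
    suff -> : [multinom m' (widen_ord (leqnSn n) i) | i < n] = m.
      by rewrite eqxx mulr1.
    apply/mnmP => i; rewrite !mnmE.
    suff -> : widen_ord (leqnSn n) i = lift ord_max i by rewrite liftK.
    by apply: val_inj; rewrite /= /bump leqNgt ltn_ord.
  rewrite coefZ coefXn.
  case: eqP => [km|_]; last by rewrite mulr0 mcoeff0.
  rewrite mulr1 mcoeffZ mcoeffX; case: eqP => [Em|_]; last by rewrite mulr0.
  case/negP: m1m'; apply/eqP/mnmP => i; rewrite mnmE.
  case: unliftP => [j|] ->; last by [].
  rewrite -Em mnmE; congr (m1 _); apply: val_inj => /=.
  by rewrite /bump leqNgt ltn_ord.
have muni0 : muni p = 0.
  apply/polyP => k; rewrite coef0; apply: IHn => v.
  have : map_poly (meval v) (muni p) = 0.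
    apply: poly_vanish => t.
    have <- := p0 (fun i => if unlift ord_max i is Some j then v j else t).
    rewrite muniE raddf_sum horner_sum mevalE; apply: eq_bigr => m _ /=.
    rewrite map_polyZ map_polyXn /= hornerZ hornerXn mevalZ mevalX -mulrA.
    congr (_ * _); rewrite big_ord_recr /= unlift_none; congr (_ * _).
    apply: eq_bigr => i _; rewrite mnmE.
    suff -> : widen_ord (leqnSn n) i = lift ord_max i by rewrite liftK.
    by apply: val_inj; rewrite /= /bump leqNgt ltn_ord.
  by move/polyP/(_ k); rewrite coef_map coef0.
apply/mpolyP => m; rewrite mcoeff0.
have := muni_coef (m ord_max) [multinom m (lift ord_max i) | i < n].
rewrite muni0 coef0 mcoeff0 => ->; congr (p@__).
by apply/mnmP => i; rewrite mnmE; case: unliftP => [j|] ->; rewrite ?mnmE.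
Qed.

(* The lowest-degree form of P at q vanishes at every tangent direction w. *)
Lemma mpoly_vanish_arcs (K : numFieldType) n (q : 'I_n -> K) (P : {mpoly K[n]}) :
  (forall w : 'I_n -> K, exists r : 'I_n -> {poly K}, forall t,
     P.@[fun i => q i + t * (w i + t * (r i).[t])] = 0) -> P = 0.
Proof.
(* Translation moves [q] to the origin. *)
move=> arcs; pose Q := P \mPo [tuple 'X_i + (q i)%:MP | i < n].
have QE v : Q.@[v] = P.@[fun i => q i + v i].
  rewrite comp_mpoly_meval; apply: meval_eq => i.
  by rewrite tnth_mktuple mevalD mevalXU mevalC addrC.
suff Q0 : Q = 0.
  apply: mpoly_vanish => v; have := QE (fun i => v i - q i).
  rewrite Q0 meval0 => /esym PE.
  by rewrite -[RHS]PE; apply: meval_eq => i; rewrite addrC subrK.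
apply/eqP/negPn/negP => Qn0.
have [m0 m0Q m0min] : exists2 m0, m0 \in msupp Q &
    forall m, m \in msupp Q -> (mdeg m0 <= mdeg m)%N.
  have exd : exists d, has (fun m => mdeg m == d) (msupp Q).
    exists (mdeg (mlead Q)); apply/hasP; exists (mlead Q) => //.
    exact: mlead_supp.
  case: (ex_minnP exd) => d /hasP[m0 m0Q /eqP <-] dmin.
  by exists m0 => // m mQ; apply: dmin; apply/hasP; exists m.
set d := mdeg m0.
pose Qd : {mpoly K[n]} := \sum_(m <- msupp Q | mdeg m == d) Q@_m *: 'X_[m].
suff Qd0 : Qd = 0.
  have : Qd@_m0 = 0 by rewrite Qd0 mcoeff0.
  rewrite /Qd raddf_sum /= big_mkcond (bigD1_seq m0) ?msupp_uniq //= eqxx.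
  rewrite big1 => [|m mm0].
    rewrite addr0 mcoeffZ mcoeffX eqxx mulr1 => /eqP.
    by rewrite mcoeff_eq0 m0Q.
  by rewrite mcoeffZ mcoeffX (negbTE mm0) mulr0 if_same.
apply: mpoly_vanish => w; have [r rP] := arcs w.
(* Along the arc, [Q] becomes ['X^d * H], and [H] at 0 is the lowest-degree form [Qd] at [w]. *)
pose H : {poly K} := \sum_(m <- msupp Q)
  Q@_m *: ('X^(mdeg m - d) * \prod_i (((w i)%:P + 'X * r i) ^+ m i)).
have H0 : H = 0.
  apply/eqP; suff: 'X^d * H == 0 by rewrite mulf_eq0 expf_eq0 polyX_eq0 andbF.
  apply/eqP/poly_vanish => t; rewrite -[RHS](rP t).
  rewrite -(QE (fun i => t * (w i + t * (r i).[t]))) mevalE.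
  rewrite hornerM hornerXn horner_sum big_distrr /=.
  rewrite big_seq [RHS]big_seq; apply: eq_bigr => m mQ.
  rewrite hornerZ hornerM hornerXn horner_prod mulrCA; congr (_ * _).
  rewrite mulrA -exprD subnKC ?m0min // mdegE -prodrXr -big_split /=.
  apply: eq_bigr => i _.
  by rewrite horner_exp !hornerE /= exprMn.
have : H.[0] = 0 by rewrite H0 horner0.
move=> <-; rewrite /Qd raddf_sum /H horner_sum /=.
rewrite [RHS](bigID (fun m => mdeg m == d)) /=.
rewrite [X in _ + X]big_seq_cond [X in _ + X]big1 ?addr0 => [|m /andP[mQ md]].
  apply: eq_bigr => m /eqP md; rewrite mevalZ mevalX hornerZ hornerM md subnn.
  rewrite expr0 hornerC mul1r horner_prod; congr (_ * _).
  by apply: eq_bigr => i _; rewrite horner_exp !hornerE.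
rewrite hornerZ hornerM hornerXn expr0n subn_eq0 leqNgt ltn_neqAle.
by rewrite eq_sym md m0min // mul0r mulr0.
Qed.

(** * Generic finiteness *)

(** The bound [msizeM_le] says that [(msize p).+1] is subadditive under products; the final 2 is its
    value at the constant 1. *)
Lemma msizeS_exp_le (K : fieldType) n (p : {mpoly K[n]}) k :
  ((msize (p ^+ k)).+1 <= k * (msize p).+1 + 2)%N.
Proof.
elim: k => [|k IHk]; first by rewrite expr0 msize1.
rewrite exprS mulSn -addnA.
apply: leq_trans (_ : _ <= (msize p).+1 + (msize (p ^+ k)).+1)%N _.
  by rewrite addSn addnS ltnS msizeM_le.
by rewrite leq_add2l.
Qed.

Lemma msizeS_prod_le (K : fieldType) n k (p : 'I_k -> {mpoly K[n]}) b :
  (forall i, (msize (p i)).+1 <= b)%N ->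
  ((msize (\prod_i p i)).+1 <= k * b + 2)%N.
Proof.
elim: k p => [|k IHk] p pb; first by rewrite big_ord0 msize1.
rewrite big_ord_recl mulSn -addnA.
apply: leq_trans (leq_add (pb ord0) (IHk _ (fun i => pb (lift ord0 i)))).
by rewrite addSn addnS ltnS msizeM_le.
Qed.

(* The D ^ k.+1 monomials of exponents < D in g and the f i lie in a space of
   dimension at most ((k.+1 * b) * D) ^ n, which is smaller for large D. *)
Lemma algebraic_over (K : fieldType) n k (f : 'I_k -> {mpoly K[n]})
    (g : {mpoly K[n]}) : (n <= k)%N ->
  exists2 Q : {poly {mpoly K[k]}}, Q != 0 &
    forall x, (map_poly (meval (fun i => (f i).@[x])) Q).[g.@[x]] = 0.
Proof.
move=> le_nk.
(* The condition [4 <= b] absorbs the constants left over by the size bounds. *)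
have [b [b4 gb fb]] : exists b, [/\ (4 <= b)%N, ((msize g).+1 <= b)%N &
    forall i, ((msize (f i)).+1 <= b)%N].
  exists (4 + (msize g).+1 + \max_i (msize (f i)).+1)%N.
  split; first by rewrite -addnA leq_addr.
    by rewrite addnAC leq_addl.
  by move=> i; apply: leq_trans (leq_addl _ _); apply: (leq_bigmax i).
(* The box [C] has [e ^ n * D ^ n] points, fewer than [D ^ n.+1], which is at most the number
   [D ^ k.+1] of exponent vectors in [T]. *)
pose e := (k.+1 * b)%N; pose D := (e ^ n).+1; pose N := (e * D)%N.
pose T := ('I_D * {ffun 'I_k -> 'I_D})%type.
pose C := {ffun 'I_n -> 'I_N}.
have ltCT : (#|C| < #|{: T}|)%N.
  rewrite card_ffun card_prod card_ffun !card_ord -expnS expnMn.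
  apply: (@leq_trans (D ^ n.+1)%N); last by rewrite leq_pexp2l.
  by rewrite expnS ltn_pmul2r ?expn_gt0.
pose mono (a : T) : {mpoly K[n]} := g ^+ a.1 * \prod_i f i ^+ a.2 i.
have mono_size a m : (N <= mdeg m)%N -> (mono a)@_m = 0.
  move=> Nm; apply/eqP; rewrite mcoeff_eq0; apply: msize_mdeg_ge.
  apply: leq_trans Nm.
  have expb (p : {mpoly K[n]}) (d : 'I_D) : ((msize p).+1 <= b)%N ->
      ((msize (p ^+ d)).+1 <= (e ^ n) * b + 2)%N.
    move=> pb; apply: leq_trans (msizeS_exp_le p d) _.
    by rewrite leq_add2r leq_mul // -ltnS ltn_ord.
  have := msizeS_prod_le (fun i => expb _ (a.2 i) (fb i)).
  have := expb _ a.1 gb; rewrite /N /e /D -/e.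
  set c := (e ^ n)%N; rewrite /mono; move: (g ^+ _) => p.
  move: (\prod_i _) => q pb qb.
  apply: leq_trans (msizeM_le p q) _; rewrite -ltnS -addnS -addSn.
  apply: leq_trans (leq_add pb qb) _; rewrite leqW //.
  have -> : (k.+1 * b * c.+1 = (c * b + b) + k * (c * b + b))%N by ring.
  have -> : (c * b + 2 + (k * (c * b + 2) + 2) =
    (c * b + 4) + k * (c * b + 2))%N by ring.
  rewrite leq_add ?leq_add2l // leq_mul // leq_add2l; exact: leq_trans b4.
pose M : 'M[K]_(#|{: T}|, #|C|) :=
  \matrix_(r, c) (mono (enum_val r))@_[multinom ((enum_val c : C) i : nat) | i < n].
(* There are more rows than columns, so the kernel yields a nontrivial linear relation between the
   products [mono a]. *)
have [u un0 uM] : exists2 u : 'rV[K]_#|{: T}|, u != 0 & u *m M = 0.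
  exists (nz_row (kermx M)).
    rewrite nz_row_eq0 kermx_eq0 /row_free neq_ltn.
    by rewrite (leq_ltn_trans (rank_leq_col _)).
  by apply/sub_kermxP; rewrite nz_row_sub.
pose c a := u 0 (enum_rank a).
have S0 : \sum_a c a *: mono a = 0.
  apply/mpolyP => m; rewrite mcoeff0 raddf_sum /=.
  have [Nm|] := leqP N (mdeg m).
    by rewrite big1 // => a _; rewrite mcoeffZ mono_size ?mulr0.
  move=> mN.
  have miN i : (m i < N)%N.
    by apply: leq_ltn_trans mN; rewrite mdegE (bigD1 i) //= leq_addr.
  pose d : C := [ffun i => Ordinal (miN i)].
  have := congr1 (fun A : 'rV_ _ => A 0 (enum_rank d)) uM.
  rewrite !mxE => uMd; apply: etrans uMd.
  rewrite (reindex (@enum_val T predT)) /=; last first.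
    exact: onW_bij (enum_val_bij _).
  apply: eq_bigr => r _; rewrite mxE mcoeffZ /c enum_valK; congr (_ * _@__).
  by apply/mnmP => i; rewrite mnmE enum_rankK ffunE.
pose mon (a : T) : 'X_{1..k} := [multinom (a.2 i : nat) | i < k].
(* The same relation with [g] and the [f i] replaced by independent variables; distinct exponents
   now give distinct monomials, so it is nonzero. *)
exists (\sum_a (c a *: 'X_[mon a]) *: 'X^(a.1)).
  apply/eqP => Q0; case/eqP: un0; apply/rowP => r; rewrite mxE.
  have := congr1 (fun Q : {poly _} => (Q`_((enum_val r).1))@_(mon (enum_val r))) Q0.
  rewrite coef0 mcoeff0 coef_sum raddf_sum /= (bigD1 (enum_val r)) //=.
  rewrite coefZ coefXn eqxx mulr1 mcoeffZ mcoeffX eqxx mulr1 /c enum_valK.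
  rewrite big1 ?addr0 // => a ar.
  rewrite coefZ coefXn; case: eqP => [a1|_]; last by rewrite mulr0 mcoeff0.
  rewrite mulr1 mcoeffZ mcoeffX; case: eqP => [a2|_]; last by rewrite mulr0.
  case/eqP: ar; case: a (enum_val r) a1 a2 => a1 a2 [r1 r2] /= E1 /mnmP E2.
  congr (_, _); first exact: val_inj.
  by apply/ffunP => i; apply: val_inj; have := E2 i; rewrite !mnmE.
move=> x; have := congr1 (meval x) S0; rewrite meval0 => SE.
rewrite -[RHS]SE !raddf_sum horner_sum /=; apply: eq_bigr => a _.
rewrite map_polyZ map_polyXn hornerZ hornerXn /= !mevalZ mevalX -mulrA.
congr (_ * _); rewrite mevalM rmorphXn rmorph_prod /= mulrC; congr (_ * _).
by apply: eq_bigr => i _; rewrite mnmE rmorphXn.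
Qed.

Definition polyfun (K : fieldType) (I : finType) (f : {ffun I -> K} -> K) :=
  exists p, forall x, poly_eval p x = f x.

(** Linear factors are split off one by one; when no root is left, the list is complete. *)
Lemma poly_roots_seq (K : fieldType) (p : {poly K}) :
  p != 0 -> exists s : seq K, forall x, root p x -> x \in s.
Proof.
elim: {p}(size p) {-2}p (leqnn (size p)) => [|n IHn] p sp pn0.
  by move: pn0; rewrite -size_poly_leq0 sp.
have [[a pa]|noroot] := pselect (exists a, root p a); last first.
  by exists [::] => x px; case: noroot; exists x.
have /factor_theorem[q pE] := pa.
have qn0 : q != 0 by apply: contraNneq pn0; rewrite pE => ->; rewrite mul0r.
have [|s sP] := IHn q _ qn0.
  by move: sp; rewrite pE size_Mmonic ?monicXsubC // size_XsubC addn2.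
exists (a :: s) => x; rewrite pE rootM root_XsubC inE => /orP[/sP ->|-> //].
by rewrite orbT.
Qed.

Lemma finite_box (K : fieldType) (E : finType) (s : E -> seq K) :
  finite_set ([set x : {ffun E -> K} | forall e, x e \in s e])%classic.
Proof.
pose N := (\max_e size (s e)).+1.
pose F (h : {ffun E -> 'I_N}) : {ffun E -> K} := [ffun e => (s e)`_(h e)].
apply: (@sub_finite_set _ _ (F @` setT)%classic); last first.
  exact/finite_image/finite_finset.
move=> x xs; exists [ffun e => inord (index (x e) (s e))] => //.
apply/ffunP => e; rewrite !ffunE inordK ?nth_index ?xs //.
rewrite ltnS; apply: leq_trans (index_size _ _) _.
exact: (leq_bigmax e).
Qed.

Lemma poly_eval_vanish (K : numFieldType) (I : finType) (p : {mpoly K[#|I|]}) :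
  (forall x, poly_eval p x = 0) -> p = 0.
Proof.
move=> p0; apply: mpoly_vanish => v.
rewrite -[RHS](p0 [ffun i => v (enum_rank i)]); apply: meval_eq => i.
by rewrite ffunE enum_valK.
Qed.

(** Each coordinate [x e] of a point of the fibre over [y] is a root of [Q e] with its coefficients
    evaluated at [y]. Where no leading coefficient vanishes these polynomials are nonzero, so the
    fibre lies in a finite box. *)
Lemma generically_finite_fibres (K : numFieldType) (E I : finType)
    (f : {ffun E -> K} -> {ffun I -> K}) : (#|E| <= #|I|)%N ->
  (forall i, polyfun (fun x => f x i)) ->
  exists U : set {ffun I -> K},
    [/\ zariski_open U, (U !=set0)%classic &
        forall y, U y -> finite_set [set x | f x = y]%classic].
Proof.
move=> leEI fpoly.
have [F FE] := fin_all_exists fpoly.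
have alg e := algebraic_over (fun i => F (enum_val i)) 'X_(enum_rank e) leEI.
have [Q Qn0 QE] := fin_all_exists2 alg.
pose P : {mpoly K[#|I|]} := \prod_e lead_coef (Q e).
exists [set y | poly_eval P y != 0]%classic; split.
- exists [set P]%classic; apply/seteqP; split => y /=.
    by move=> /negP/negPn/eqP Py p ->.
  by move=> /(_ P erefl) ->; rewrite eqxx.
- have /eqP Pn0 : P != 0 by apply/prodf_neq0 => e _; rewrite lead_coef_eq0.
  apply: contrapT => U0; apply/Pn0/poly_eval_vanish => y.
  by apply/eqP/negPn/negP => Py; apply: U0; exists y.
move=> y Py.
pose S e := map_poly (meval (fun i => y (enum_val i))) (Q e).
have Sn0 e : S e != 0.
  apply: contraNneq Py => Se0; rewrite /poly_eval rmorph_prod /=.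
  rewrite (bigD1 e) //= (_ : meval _ _ = 0) ?mul0r //.
  have := congr1 (fun p : {poly K} => p`_(size (Q e)).-1) Se0.
  by rewrite coef_map coef0.
have [s sP] := fin_all_exists (fun e => poly_roots_seq (Sn0 e)).
apply: sub_finite_set (finite_box s) => x /= fx e; apply: sP.
have := QE e (fun k => x (enum_val k)); rewrite mevalXU enum_rankK => QE0.
apply/eqP; rewrite -[RHS]QE0; congr (_.[_]); apply: eq_map_poly => q.
by apply: meval_eq => i; rewrite [RHS]FE fx.
Qed.

(** * The Heron variety *)

Section PolyFun.
Variables (K : fieldType) (I : finType).
Implicit Types f g : {ffun I -> K} -> K.

Lemma polyfun_ext f g : f =1 g -> polyfun f -> polyfun g.
Proof. by move=> fg [p pf]; exists p => x; rewrite pf. Qed.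

Lemma polyfun_coord i : polyfun (fun x : {ffun I -> K} => x i).
Proof.
by exists 'X_(enum_rank i) => x; rewrite /poly_eval mevalXU enum_rankK.
Qed.

Lemma polyfun_const (c : K) : polyfun (fun _ : {ffun I -> K} => c).
Proof. by exists c%:MP => x; rewrite /poly_eval mevalC. Qed.

Lemma polyfunD f g : polyfun f -> polyfun g -> polyfun (fun x => f x + g x).
Proof.
by move=> [p pf] [q qg]; exists (p + q) => x; rewrite -pf -qg; apply: mevalD.
Qed.

Lemma polyfunM f g : polyfun f -> polyfun g -> polyfun (fun x => f x * g x).
Proof.
by move=> [p pf] [q qg]; exists (p * q) => x; rewrite -pf -qg; apply: mevalM.
Qed.

Lemma polyfunB f g : polyfun f -> polyfun g -> polyfun (fun x => f x - g x).
Proof.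
by move=> [p pf] [q qg]; exists (p - q) => x; rewrite -pf -qg; apply: mevalB.
Qed.

Lemma polyfunX f m : polyfun f -> polyfun (fun x => f x ^+ m).
Proof. by move=> [p pf]; exists (p ^+ m) => x; rewrite -pf; apply: rmorphXn. Qed.

Lemma polyfun_det n (A : {ffun I -> K} -> 'M[K]_n) :
  (forall i j, polyfun (fun x => A x i j)) -> polyfun (fun x => \det (A x)).
Proof.
move=> polyA; have [p pA] := fin_all_exists (fun i => fin_all_exists (polyA i)).
exists (\det (\matrix_(i, j) p i j)) => x.
rewrite /poly_eval -det_map_mx; congr (\det _).
by apply/matrixP => i j; rewrite !mxE; apply: pA.
Qed.

End PolyFun.

Lemma polyfun_cayley_menger (K : fieldType) (I : finType) n
    (x : {ffun I -> K} -> {ffun edge n -> K}) (S : {set 'I_n.+1}) :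
  (forall e, polyfun (fun z => x z e)) -> polyfun (fun z => cayley_menger (x z) S).
Proof.
move=> xpoly; apply: polyfunM; first exact: polyfun_const.
apply: polyfun_det => i j; rewrite /block_mx.
apply: (@polyfun_ext _ _ (fun z =>
  match split i, split j with
  | inl _, inl _ => 0
  | inr a, inr b => sq_dist (x z) (enum_val a) (enum_val b)
  | _, _ => 1
  end)).
  by move=> z; rewrite !mxE; case: split => a; rewrite !mxE; case: split => b;
    rewrite !mxE.
case: split => a; case: split => b; try exact: polyfun_const.
rewrite /sq_dist; case: insubP => [e _ _|_]; first exact: xpoly.
exact: polyfun_const.
Qed.

(** * Cayley-Menger determinants by Laplace expansion *)

Lemma det_reindex (R : comRingType) m n (h : 'I_m -> 'I_n) (A : 'M[R]_n) :
  bijective h -> \det (\matrix_(i, j) A (h i) (h j)) = \det A.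
Proof.
move=> hbij; have := bij_eq_card hbij; rewrite !card_ord => mn.
case: n / mn h A hbij => h A hbij.
pose s := perm (bij_inj hbij).
have -> : \matrix_(i, j) A (h i) (h j) = row_perm s (col_perm s A).
  by apply/matrixP => i j; rewrite !mxE !permE.
(* Rows and columns undergo the same permutation, so its sign enters twice. *)
rewrite row_permE col_permE !det_mulmx !det_perm odd_permV.
by rewrite mulrC -mulrA -expr2 sqrr_sign mulr1.
Qed.

(** Expansion along the first row, on matrices given as functions of natural numbers, so that
    determinants unfold by simplification or evaluate by [vm_compute]. *)
Fixpoint laplace (R : comRingType) n (A : nat -> nat -> R) : R :=
  if n is m.+1 then
    foldr (fun j s => (-1) ^+ j * A 0%N j *
             laplace m (fun i k => A i.+1 (bump j k)) + s) 0 (iota 0 n)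
  else 1.

Lemma det_laplace (R : comRingType) n (A : nat -> nat -> R) :
  \det (\matrix_(i < n, j < n) A i j) = laplace n A.
Proof.
elim: n A => [|n IHn] A; first by rewrite det_mx00.
rewrite (expand_det_row _ ord0) /=.
transitivity (\sum_(0 <= j < n.+1) ((-1) ^+ j * A 0%N j *
   laplace n (fun i k => A i.+1 (bump j k)))); last by rewrite unlock.
rewrite big_mkord; apply: eq_bigr => j _; rewrite mxE /cofactor add0n.
rewrite mulrA [A _ _ * _]mulrC -IHn; congr (_ * \det _).
by apply/matrixP => i k; rewrite !mxE.
Qed.

Lemma eq_laplace (R : comRingType) n (A B : nat -> nat -> R) :
  (forall i j, i < n -> j < n -> A i j = B i j)%N -> laplace n A = laplace n B.
Proof.
move=> AB; rewrite -!det_laplace; congr (\det _).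
by apply/matrixP => i j; rewrite !mxE AB.
Qed.

Lemma laplace_morph (R S : comRingType) (f : {rmorphism R -> S}) n A :
  f (laplace n A) = laplace n (fun i j => f (A i j)).
Proof.
rewrite -!det_laplace -det_map_mx; congr (\det _).
by apply/matrixP => i j; rewrite !mxE.
Qed.

Definition bordered (R : comRingType) (D : nat -> nat -> R) (i j : nat) : R :=
  match i, j with
  | 0%N, 0%N => 0
  | i'.+1, j'.+1 => D i' j'
  | _, _ => 1
  end.

Section Distances.
Variables (K : fieldType) (n : nat) (x : {ffun edge n -> K}).

Lemma sq_distC i j : sq_dist x i j = sq_dist x j i.
Proof. by rewrite /sq_dist finset.setUC. Qed.

Lemma sq_dist0 i : sq_dist x i i = 0.
Proof. by rewrite /sq_dist insubF // finset.setUid cards1. Qed.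

(** The determinant does not depend on the order of the vertices, so [enum S] can be replaced by any
    explicit enumeration. *)
Lemma cayley_menger_seq (S : {set 'I_n.+1}) (s : seq 'I_n.+1) :
  uniq s -> S =i s ->
  cayley_menger x S =
    let m := (size s).-1 in
    (-1) ^+ m.+1 / ((m`!)%:R ^+ 2 * 2 ^+ m) *
    laplace (size s).+1
      (bordered (fun a b => sq_dist x (nth ord0 s a) (nth ord0 s b))).
Proof.
move=> s_uniq Ss; have cardS : #|S| = size s.
  by rewrite (eq_card Ss) (card_uniqP s_uniq).
rewrite /cayley_menger -cardS; cbv zeta; congr (_ * _).
rewrite -det_laplace.
pose d a b := sq_dist x (nth ord0 (enum S) a) (nth ord0 (enum S) b).
transitivity (\det (\matrix_(i < #|S|.+1, j < #|S|.+1) bordered d i j)).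
  congr (\det _); apply/matrixP => i j; rewrite !mxE.
  case: splitP => a ia; rewrite ?ord1 /= in ia; rewrite !mxE; 
  case: splitP => b jb; rewrite ?ord1 /= in jb; rewrite !mxE ia jb //=.
  by rewrite /d -!enum_val_nth.
(* The reindexing fixes the border index 0 and sends a position in [s] to the position of the same
   vertex in [enum S], both shifted by one. *)
have hP (i : 'I_#|S|.+1) :
    ((if val i is k.+1 then (index (nth ord0 s k) (enum S)).+1 else 0%N)
      < #|S|.+1)%N.
  case: i => [[|k] //= ik]; rewrite ltnS cardE index_mem mem_enum Ss mem_nth //.
  by rewrite -cardS.
pose h i := Ordinal (hP i).
have hinj : injective h.
  move=> [a ia] [b ib] /(congr1 val) /= hab; apply: val_inj => /=.
  case: a ia hab => [|a] ia; case: b ib => [|b] ib //= [hab]; congr _.+1.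
  have sa : (a < size s)%N by rewrite -cardS.
  have sb : (b < size s)%N by rewrite -cardS.
  apply/eqP; rewrite -(nth_uniq ord0 sa sb s_uniq); apply/eqP.
  rewrite -[LHS](@nth_index _ ord0 _ (enum S)) ?mem_enum ?Ss ?mem_nth //.
  by rewrite hab nth_index // mem_enum Ss mem_nth.
have hbij : bijective h by apply: inj_card_bij.
rewrite -(det_reindex _ hbij); congr (\det _).
apply/matrixP => i j; rewrite !mxE.
case: i => [[|i] ii]; case: j => [[|j] jj] //=.
have si : (i < size s)%N by rewrite -cardS.
have sj : (j < size s)%N by rewrite -cardS.
by rewrite /d !nth_index ?mem_enum ?Ss ?mem_nth.
Qed.

End Distances.

Lemma cayley_menger_edge (K : numFieldType) n (x : {ffun edge n -> K}) e :
  cayley_menger x (val e) = x e.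
Proof.
have ce : #|val e| == 2%N := valP e.
have [i [j [ij eE]]] := cards2P _ ce.
rewrite eE (@cayley_menger_seq _ _ _ _ [:: i; j]); first last.
- by move=> k; rewrite !inE.
- by rewrite /= inE ij.
have sdE : sq_dist x i j = x e by rewrite /sq_dist -eE valK.
rewrite /= /bump /= (sq_distC x j i) !sq_dist0 sdE factS fact0.
by field.
Qed.

(* 16 area^2 and 144 volume^2 in terms of squared lengths. *)
Definition heron2 (K : fieldType) (a b c : K) : K :=
  2 * (a * b + a * c + b * c) - a ^+ 2 - b ^+ 2 - c ^+ 2.

Definition heron3 (K : fieldType) (a b c d e f : K) : K :=
  a * f * (b + c + d + e - a - f) + b * e * (a + c + d + f - b - e) +
  c * d * (a + b + e + f - c - d) -
  a * b * d - a * c * e - b * c * f - d * e * f.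

Lemma cayley_menger_triangle (K : numFieldType) n (x : {ffun edge n -> K})
    (S : {set 'I_n.+1}) (i j k : 'I_n.+1) : uniq [:: i; j; k] ->
  S =i [:: i; j; k] ->
  cayley_menger x S = heron2 (sq_dist x i j) (sq_dist x i k) (sq_dist x j k) / 16.
Proof.
move=> ijk SE; rewrite /heron2 (cayley_menger_seq x ijk SE) /= /bump /=.
rewrite (sq_distC x j i) (sq_distC x k i) (sq_distC x k j) !sq_dist0.
rewrite !factS fact0; by field.
Qed.

Lemma cayley_menger_tetrahedron (K : numFieldType) n (x : {ffun edge n -> K})
    (S : {set 'I_n.+1}) (i j k l : 'I_n.+1) : uniq [:: i; j; k; l] ->
  S =i [:: i; j; k; l] ->
  cayley_menger x S =
    heron3 (sq_dist x i j) (sq_dist x i k) (sq_dist x i l)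
           (sq_dist x j k) (sq_dist x j l) (sq_dist x k l) / 144.
Proof.
move=> ijkl SE; rewrite /heron3 (cayley_menger_seq x ijkl SE) /= /bump /=.
rewrite (sq_distC x j i) (sq_distC x k i) (sq_distC x k j) (sq_distC x l i).
rewrite (sq_distC x l j) (sq_distC x l k) !sq_dist0.
rewrite !factS fact0; by field.
Qed.

(** * The Heron variety as a graph; criteria for finiteness and dominance *)

Section HeronVariety.
Variables (K : numFieldType) (n : nat).

Lemma edge_face_subproof (e : edge n) : (2 <= #|val e|)%N.
Proof. by rewrite (eqP (valP e)). Qed.

Definition edge_face (e : edge n) : face n := Sub (val e) (edge_face_subproof e).

Lemma heron_map_edge (x : {ffun edge n -> K}) e : heron_map x (edge_face e) = x e.
Proof. by rewrite ffunE SubK cayley_menger_edge. Qed.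

(** Each face coordinate is a fixed polynomial in the edge coordinates. These equations hold on the
    image, hence on its closure, and there they exhibit a preimage. *)
Lemma heron_varietyE : heron_variety K n = range (@heron_map K n).
Proof.
apply/seteqP; split => z; last by move=> [x _ <-] p; apply; exists x.
move=> zX; pose edges (z : {ffun face n -> K}) := [ffun e => z (edge_face e)].
exists (edges z) => //; apply/ffunP => S; rewrite ffunE.
have [p pE] : polyfun (fun z : {ffun face n -> K} =>
    cayley_menger (edges z) (val S) - z S).
  apply: polyfunB; last exact: polyfun_coord.
  apply: polyfun_cayley_menger => e.
  by apply: polyfun_ext (polyfun_coord K (edge_face e)) => y; rewrite ffunE.
apply/eqP; rewrite -subr_eq0 -(pE z); apply/eqP/zX => _ [x _ <-].
rewrite pE; apply/eqP; rewrite subr_eq0 [eqbRHS]ffunE; apply/eqP.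
by congr cayley_menger; apply/ffunP => e; rewrite ffunE heron_map_edge.
Qed.

Lemma heron_generically_finite (B : {set face n}) : (#|{: edge n}| <= #|B|)%N ->
  generically_finite_on (heron_variety K n) (coord_proj B).
Proof.
move=> leB; pose f (x : {ffun edge n -> K}) := coord_proj B (heron_map x).
have [|i|U [Uo Un0 Ufin]] := generically_finite_fibres (f := f).
- rewrite [X in (_ <= X)%N]card_sig; apply: leq_trans leB _.
  by rewrite subset_leq_card.
- apply: (@polyfun_ext _ _ (fun x => cayley_menger x (val (val i)))).
    by move=> x; rewrite !ffunE.
  by apply: polyfun_cayley_menger => e; apply: polyfun_coord.
exists U; split=> // y /Ufin fin_y; rewrite heron_varietyE.
apply: sub_finite_set (finite_image (@heron_map K n) fin_y).
by move=> _ [[x _ <-] /= xy]; exists x.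
Qed.

(** The hypothesis provides arcs in the image whose [B]-coordinates start at those of [heron_map p]
    with arbitrary velocity [w]; by [mpoly_vanish_arcs] no nonzero polynomial vanishes on the
    projection. *)
Lemma heron_dominant (B : {set face n}) (p : {ffun edge n -> K}) :
  (forall w : face n -> K,
     exists (x : K -> {ffun edge n -> K}) (r : face n -> {poly K}), forall t S,
       S \in B -> heron_map (x t) S =
       heron_map p S + t * (w S + t * (r S).[t])) ->
  dominant_on (heron_variety K n) (coord_proj B).
Proof.
move=> arcs; apply/seteqP; split => // y _ P PX.
suff -> : P = 0 by rewrite /poly_eval meval0.
apply: (mpoly_vanish_arcs (q := fun k => heron_map p (val (enum_val k)))) => w.
(* A velocity on [B] is extended by 0 to the other faces. *)
have [x [r xr]] := arcs (fun S => if insub S is Some b then w (enum_rank b) else 0).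
exists (fun k => r (val (enum_val k))) => t.
rewrite -[RHS](PX (coord_proj B (heron_map (x t)))); last first.
  exists (heron_map (x t)) => //; rewrite heron_varietyE; by exists (x t).
apply: meval_eq => k; transitivity (heron_map (x t) (val (enum_val k))).
  by rewrite xr ?(valP (enum_val k)) // valK enum_valK.
by rewrite [RHS]ffunE.
Qed.

(** The function [g] is a relation between the coordinates in [B], and [y] witnesses that it is not
    the zero relation. *)
Lemma heron_not_dominant (B : {set face n})
    (g : {ffun {S : face n | S \in B} -> K} -> K) y : polyfun g ->
  (forall x, g (coord_proj B (heron_map x)) = 0) -> g y != 0 ->
  ~ dominant_on (heron_variety K n) (coord_proj B).
Proof.
move=> [p pg] g0 gy dom; case/eqP: gy; rewrite -pg.
have : zariski_closure (coord_proj B @` heron_variety K n)%classic y by rewrite dom.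
apply=> _ [z zX <-]; move: zX; rewrite heron_varietyE => -[x _ <-].
by rewrite pg g0.
Qed.

End HeronVariety.

(** * Codes for sets of faces of the tetrahedron *)

Fixpoint sublists (T : Type) (s : seq T) : seq (seq T) :=
  if s is x :: s' then let r := sublists s' in map (cons x) r ++ r else [:: [::]].

Lemma filter_sublists (T : eqType) (a : pred T) s : filter a s \in sublists s.
Proof.
elim: s => //= x s IHs; rewrite mem_cat; case: (a x); last by rewrite IHs orbT.
by rewrite map_f.
Qed.

(* A face of the tetrahedron is coded by its position in this list, and a set
   of faces by the increasing list of the codes of its elements. *)
Definition face_vertices : seq (seq nat) :=
  [:: [:: 0; 1]; [:: 0; 2]; [:: 0; 3]; [:: 1; 2]; [:: 1; 3]; [:: 2; 3];
      [:: 0; 1; 2]; [:: 0; 1; 3]; [:: 0; 2; 3]; [:: 1; 2; 3];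
      [:: 0; 1; 2; 3]]%N.

Definition vertices (S : {set 'I_4}) : seq nat :=
  [seq i <- iota 0 4 | (inord i : 'I_4) \in S].

Definition code (S : {set 'I_4}) : nat := index (vertices S) face_vertices.

Lemma mem_vertices (S : {set 'I_4}) (i : 'I_4) : (val i \in vertices S) = (i \in S).
Proof. by rewrite mem_filter mem_iota /= ltn_ord andbT inord_val. Qed.

Lemma vertices_inj : injective vertices.
Proof. by move=> S T ST; apply/setP => i; rewrite -!mem_vertices ST. Qed.

Lemma size_vertices (S : {set 'I_4}) : size (vertices S) = #|S|.
Proof.
rewrite cardE -(size_map val (enum S)); apply: perm_size; apply: uniq_perm.
- exact/filter_uniq/iota_uniq.
- by rewrite map_inj_uniq ?enum_uniq //; apply: val_inj.
move=> i; rewrite mem_filter mem_iota /=; apply/andP/mapP.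
  by move=> [iS i4]; exists (inord i); rewrite ?mem_enum //= inordK.
by move=> [j]; rewrite mem_enum => jS ->; rewrite inord_val ltn_ord.
Qed.

Lemma vertices_face (S : face 3) : vertices (val S) \in face_vertices.
Proof.
have : (2 <= size (vertices (val S)))%N by rewrite size_vertices (valP S).
have : vertices (val S) \in sublists (iota 0 4) by apply: filter_sublists.
move: (vertices _) => l lsub l2.
by move/allP: (isT : all (fun l => (2 <= size l)%N ==> (l \in face_vertices))
  (sublists (iota 0 4))) => /(_ l lsub); rewrite l2.
Qed.

Lemma code_lt (S : face 3) : (code (val S) < 11)%N.
Proof. by rewrite -[11%N]/(size face_vertices) index_mem vertices_face. Qed.

Lemma nth_code (S : face 3) :
  nth [::] face_vertices (code (val S)) = vertices (val S).
Proof. by rewrite nth_index // vertices_face. Qed.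

Lemma code_inj (S T : face 3) : code (val S) = code (val T) -> S = T.
Proof.
by move=> ST; apply/val_inj/vertices_inj; rewrite -nth_code ST nth_code.
Qed.

Definition vertex_set (l : seq nat) : {set 'I_4} := [set i : 'I_4 | val i \in l].

Lemma vertices_vertex_set l :
  vertices (vertex_set l) = [seq i <- iota 0 4 | i \in l].
Proof.
apply: eq_in_filter => i; rewrite mem_iota inE /= => i4.
by rewrite inordK.
Qed.

Lemma code_surj k : (k < 11)%N -> exists S : face 3, code (val S) = k.
Proof.
move=> k11; set l := nth [::] face_vertices k.
have lE : vertices (vertex_set l) = l.
  rewrite vertices_vertex_set.
  have : l \in face_vertices by rewrite mem_nth.
  move: l => l lf; apply/eqP; move: l lf; apply/allP; exact: isT.
have l2 : (2 <= #|vertex_set l|)%N.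
  rewrite -size_vertices lE; have : l \in face_vertices by rewrite mem_nth.
  move: (l); apply/allP; exact: isT.
by exists (Sub (vertex_set l) l2); rewrite SubK /code lE index_uniq.
Qed.

(** The canonical form of a list of codes: increasing and without repetition, so that equality of
    lists is equality of sets. *)
Definition normalize (ks : seq nat) : seq nat := [seq k <- iota 0 11 | k \in ks].

Definition codes (A : {set face 3}) : seq nat :=
  [seq k <- iota 0 11 | [exists F in A, code (val F) == k]].

Lemma mem_codes (A : {set face 3}) S : (code (val S) \in codes A) = (S \in A).
Proof.
rewrite mem_filter mem_iota /= code_lt andbT; apply/exists_inP/idP.
  by move=> [T TA /eqP/code_inj <-].
by exists S.
Qed.

Lemma codes_inj : injective codes.
Proof. by move=> A B AB; apply/setP => S; rewrite -!mem_codes AB. Qed.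

Lemma codesP (A : {set face 3}) k :
  reflect (exists2 S, S \in A & k = code (val S)) (k \in codes A).
Proof.
apply: (iffP idP) => [|[S SA ->]]; last by rewrite mem_codes.
by rewrite mem_filter => /andP[/exists_inP[S SA /eqP <-] _]; exists S.
Qed.

Lemma size_codes (A : {set face 3}) : size (codes A) = #|A|.
Proof.
rewrite cardE -(size_map (fun S : face 3 => code (val S)) (enum A)).
apply: perm_size; apply: uniq_perm.
- exact/filter_uniq/iota_uniq.
- by rewrite map_inj_uniq ?enum_uniq //; apply: code_inj.
move=> k; apply/codesP/mapP => -[S SA ->]; exists S => //.
  by rewrite mem_enum.
by rewrite -mem_enum.
Qed.

Lemma codes_sub (A B : {set face 3}) : (A \subset B) = all (mem (codes B)) (codes A).
Proof.
apply/fintype.subsetP/allP => AB => [_ /codesP[S SA ->]|S].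
  by change (code (val S) \in codes B); rewrite mem_codes AB.
by rewrite -!mem_codes => /AB.
Qed.

Definition set_of_codes (ks : seq nat) : {set face 3} :=
  [set S : face 3 | code (val S) \in ks].

Lemma codes_set_of_codes ks : codes (set_of_codes ks) = normalize ks.
Proof.
apply: eq_in_filter => k; rewrite mem_iota => /= /code_surj[S <-].
apply/exists_inP/idP => [[T]|kS]; first by rewrite inE => Tk /eqP <-.
by exists S; rewrite ?inE.
Qed.

Lemma codes_set_of_codesP ks : ks \in sublists (iota 0 11) ->
  codes (set_of_codes ks) = ks.
Proof.
rewrite codes_set_of_codes => ksub; apply/eqP; move: ks ksub.
by apply/allP; vm_compute.
Qed.

(** Labels start at 1 and vertices at 0, hence [i.+1]; the zeros by which [digits4] pads a short
    number match no vertex. *)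
Definition digits_code (d : nat) : nat :=
  index [seq i <- iota 0 4 | i.+1 \in digits4 d] face_vertices.

Lemma codes_faces ds : codes (faces ds) = normalize (map digits_code ds).
Proof.
suff -> : faces ds = set_of_codes (map digits_code ds) by exact: codes_set_of_codes.
have vl d : vertices (labelled d) = [seq i <- iota 0 4 | i.+1 \in digits4 d].
  by apply: eq_in_filter => i; rewrite mem_iota inE /= => i4; rewrite inordK.
apply/setP => S; rewrite !inE; apply/mapP/mapP => -[d dds Sd]; exists d => //.
  by rewrite Sd /code vl.
apply: vertices_inj; rewrite vl -nth_code Sd nth_index //.
by rewrite -index_mem -/(digits_code d) -Sd code_lt.
Qed.

(** * The action of the symmetric group on codes *)

Definition perm_table (s : {perm 'I_4}) : seq nat :=
  [seq val (s (inord i)) | i <- iota 0 4].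

Definition code_act (l : seq nat) (k : nat) : nat :=
  index [seq i <- iota 0 4 | i \in map (nth 0%N l) (nth [::] face_vertices k)]
    face_vertices.

Definition code_orbit (ks : seq nat) : seq (seq nat) :=
  [seq normalize (map (code_act l) ks) | l <- permutations (iota 0 4)].

Lemma perm_tableP l :
  reflect (exists s, perm_table s = l) (l \in permutations (iota 0 4)).
Proof.
rewrite mem_permutations; apply: (iffP idP) => [pl|[s <-]]; last first.
  apply: uniq_perm; rewrite ?iota_uniq //.
    rewrite map_inj_in_uniq ?iota_uniq // => i j; rewrite !mem_iota /= => i4 j4.
    by move=> /val_inj/perm_inj/(congr1 val) /=; rewrite !inordK.
  move=> i; apply/mapP/idP => [[j _ ->]|]; first by rewrite mem_iota /= ltn_ord.
  rewrite mem_iota /= => i4; exists (val (s^-1%g (inord i))).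
    by rewrite -[[:: _; _; _; _]]/(iota 0 4) mem_iota ltn_ord.
  by rewrite inord_val permKV inordK.
have l4 : size l = 4%N by rewrite (perm_size pl).
have lt4 i : (i < 4)%N -> (nth 0%N l i < 4)%N.
  move=> i4; have : nth 0%N l i \in iota 0 4 by rewrite -(perm_mem pl) mem_nth ?l4.
  by rewrite mem_iota.
have finj : injective (fun i : 'I_4 => inord (nth 0%N l i) : 'I_4).
  move=> i j /(congr1 val) /=; rewrite !inordK ?lt4 // => /eqP.
  rewrite nth_uniq ?l4 ?ltn_ord // ?(perm_uniq pl) ?iota_uniq // => /eqP.
  exact: val_inj.
exists (perm finj); apply: (@eq_from_nth _ 0%N).
  by rewrite size_map size_iota l4.
move=> i; rewrite size_map size_iota => i4.
by rewrite (nth_map 0%N) ?size_iota // nth_iota // permE /= !inordK ?lt4.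
Qed.

Lemma nth_perm_table s (i : 'I_4) : nth 0%N (perm_table s) i = s i.
Proof.
by rewrite (nth_map 0%N) ?size_iota // nth_iota // add0n inord_val.
Qed.

Lemma code_face_perm (S : face 3) s :
  code (val (face_perm S s)) = code_act (perm_table s) (code (val S)).
Proof.
rewrite /code_act nth_code SubK; congr index; apply: eq_in_filter => i.
rewrite mem_iota /= => i4; apply/imsetP/mapP.
  move=> [j jS ij]; exists (val j); first by rewrite mem_vertices.
  by rewrite nth_perm_table -ij inordK.
move=> [j]; rewrite mem_filter mem_iota /= => /andP[jS j4] ij.
exists (inord j) => //; apply: val_inj => /=.
by rewrite inordK // -nth_perm_table inordK.
Qed.

Lemma codes_act (A : {set face 3}) s : codes ((face_action 3)^*%act A s) =
  normalize (map (code_act (perm_table s)) (codes A)).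
Proof.
apply: eq_in_filter => k _; apply/exists_inP/mapP.
  move=> [_ /imsetP[S SA ->] /eqP <-]; exists (code (val S)).
    by rewrite mem_codes.
  exact: code_face_perm.
move=> [_ /codesP[S SA ->] ->]; exists (face_perm S s).
  by apply/imsetP; exists S.
by rewrite code_face_perm.
Qed.

(** Lists [l] in [code_orbit] run over exactly the tables of the 24 permutations, so orbit
    membership becomes computable. *)
Lemma mem_face_orbit (A B : {set face 3}) :
  (A \in face_orbit B) = (codes A \in code_orbit (codes B)).
Proof.
apply/orbitP/mapP => [[s _ <-]|[l /perm_tableP[s <-] AB]].
  by exists (perm_table s); [apply/perm_tableP; exists s|rewrite codes_act].
by exists s; rewrite ?inE //; apply: codes_inj; rewrite codes_act.
Qed.

Lemma face_orbit_eq (A B : {set face 3}) :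
  (face_orbit A == face_orbit B) = (A \in face_orbit B).
Proof. exact/eqP/orbit_eqP. Qed.

(** * Heron coordinates of the tetrahedron *)

Section HeronCodes.
Variable K : numFieldType.
Implicit Types v u : nat -> K.

(** The entries follow the order of [face_vertices], and [v k] is the squared length of the edge
    with code [k]. *)
Definition heron_coords v : seq K :=
  [:: v 0; v 1; v 2; v 3; v 4; v 5;
      heron2 (v 0) (v 1) (v 3) / 16; heron2 (v 0) (v 2) (v 4) / 16;
      heron2 (v 1) (v 2) (v 5) / 16; heron2 (v 3) (v 4) (v 5) / 16;
      heron3 (v 0) (v 1) (v 2) (v 3) (v 4) (v 5) / 144]%N.

Definition edge_lengths v : {ffun edge 3 -> K} := [ffun e => v (code (val e))].

Lemma edge_lengths_surj x : exists v, x = edge_lengths v.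
Proof.
exists (fun k => if [pick e : edge 3 | code (val e) == k] is Some e then x e else 0).
apply/ffunP => e; rewrite ffunE.
case: pickP => [f /eqP fe|/(_ e)]; last by rewrite eqxx.
have := @code_inj (edge_face f) (edge_face e); rewrite !SubK => /(_ fe).
by move/(congr1 val); rewrite !SubK => /val_inj ->.
Qed.

Lemma sq_dist_edge_lengths v (i j : 'I_4) : i != j ->
  sq_dist (edge_lengths v) i j = v (code [set i; j]).
Proof.
move=> ij; rewrite /sq_dist insubT ?cards2 ?ij // => e2.
by rewrite ffunE SubK.
Qed.

Lemma code_edge (a b : nat) : (a < 4)%N -> (b < 4)%N ->
  code [set inord a; inord b] =
  index [seq i <- iota 0 4 | (i == a) || (i == b)] face_vertices.
Proof.
move=> a4 b4; congr index; apply: eq_in_filter => i.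
by rewrite mem_iota !inE /= => i4; rewrite -!val_eqE /= !inordK.
Qed.

Lemma heron_map_code v S :
  heron_map (edge_lengths v) S = (heron_coords v)`_(code (val S)).
Proof.
have inord_neq a b : (a < 4)%N -> (b < 4)%N -> a != b -> (inord a : 'I_4) != inord b.
  by move=> a4 b4; rewrite -val_eqE /= !inordK.
rewrite ffunE; have := code_lt S; have := nth_code S.
have memS l : l = vertices (val S) ->
    all (fun i => i < 4)%N l -> val S =i [seq inord i | i <- l].
  move=> -> l4 i; rewrite -mem_vertices; apply/idP/mapP => [iS|[j jS ->]].
    by exists (val i) => //; rewrite inord_val.
  by rewrite /= inordK // (allP l4).
have edgeS : (code (val S) < 6)%N ->
    cayley_menger (edge_lengths v) (val S) = v (code (val S)).
  move=> S6; have S2 : #|val S| == 2%N.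
    rewrite -size_vertices -nth_code; move: (code _) S6.
    by do 6?[case=> //].
  by have := cayley_menger_edge (edge_lengths v) (Sub (val S) S2);
    rewrite SubK ffunE SubK.
move: (code (val S)) edgeS => k edgeS SE k11.
have [k6|] := ltnP k 6; first by
  rewrite edgeS //; move: k k6 {edgeS SE k11}; do 6?[case=> //].
move: k k11 SE {edgeS}; do 11?[case=> //=] => _ /memS /(_ isT) /= SE _;
  rewrite ?(cayley_menger_triangle _ _ SE) ?(cayley_menger_tetrahedron _ _ SE) /=
    ?inE ?negb_or ?inord_neq //;
  by rewrite !sq_dist_edge_lengths ?inord_neq // !code_edge.
Qed.


(* At the edge lengths base_point, row k is the gradient of the k-th Heron
   coordinate, cleared of the denominator scale k. *)
Definition base_point (k : nat) : K := (nth 0 [:: 1; 2; 3; 5; 7; 4] k)%:R.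

Definition scale (k : nat) : K :=
  if (k < 6)%N then 1 else if (k < 10)%N then 16 else 144.

Definition gradient (R : comRingType) (k e : nat) : R :=
  (nth 0 (nth [::]
  [:: [:: 1; 0; 0; 0; 0; 0]; [:: 0; 1; 0; 0; 0; 0]; [:: 0; 0; 1; 0; 0; 0];
      [:: 0; 0; 0; 1; 0; 0]; [:: 0; 0; 0; 0; 1; 0]; [:: 0; 0; 0; 0; 0; 1];
      [:: 12; 8; 0; -4; 0; 0]; [:: 18; 0; 10; 0; -6; 0];
      [:: 0; 10; 6; 0; 0; 2]; [:: 0; 0; 0; 12; 4; 16];
      [:: 42; 16; 18; -9; -10; -4]]%Z k) e : int)%:~R.

Arguments gradient : clear implicits.

(** This is the Taylor expansion along a line through the base point: edges are linear, triangles
    quadratic, the tetrahedron cubic in [t], which makes [r] zero, constant and linear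
    respectively. *)
Lemma heron_arc k u : (k < 11)%N -> exists r : {poly K}, forall t,
  (heron_coords (fun e => base_point e + t * u e))`_k =
  (heron_coords base_point)`_k +
    t * ((\sum_(e < 6) gradient K k e * u e) / scale k + t * r.[t]).
Proof.
move=> k11; have [k6|k6] := ltnP k 6.
  exists 0 => t; rewrite horner0 mulr0 addr0 /scale k6 divr1.
  move: k k6 {k11}; do 6?[case=> //=] => _;
    rewrite !big_ord_recr big_ord0 /= /gradient /=; ring.
have [k10|k10] := ltnP k 10.
  exists ((nth 0 (heron_coords u) k)%:P) => t.
  rewrite hornerC /scale ltnNge k6 /= k10.
  move: k k6 k10 {k11}; do 10?[case=> //=] => _ _;
    by rewrite !big_ord_recr big_ord0 /= /gradient /base_point /heron2 /=; field.
have kE : k = 10%N by apply/eqP; rewrite eqn_leq -ltnS k11.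
pose h (v : nat -> K) := heron3 (v 0) (v 1) (v 2) (v 3) (v 4) (v 5).
pose L := \sum_(e < 6) gradient K 10 e * u e.
(* The quadratic coefficient of the cubic, read off by setting [t] to 1. *)
pose a := h (fun e => base_point e + u e) - h base_point - L - h u.
exists ((a / 144)%:P + (h u / 144)%:P * 'X) => t.
rewrite kE !hornerE /a /L /h !big_ord_recr big_ord0 /=.
by rewrite /gradient /scale /base_point /heron3 /=; field.
Qed.

(** When the Jacobian is invertible, a linear system yields a direction [u] of edge lengths that
    produces any prescribed velocity on [B]. *)
Lemma heron_codes_dominant (B : {set face 3}) : size (codes B) = 6%N ->
  laplace 6 (fun a e => gradient Z (nth 0%N (codes B) a) e) != 0 ->
  dominant_on (heron_variety K 3) (coord_proj B).
Proof.
move=> B6 detB; apply: (heron_dominant (p := edge_lengths base_point)) => w.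
have scale_neq0 k : scale k != 0.
  by rewrite /scale; do 2?case: ifP; rewrite ?oner_eq0 ?pnatr_eq0.
pose G (R : comRingType) (a e : nat) := gradient R (nth 0%N (codes B) a) e.
pose M : 'M[K]_6 := \matrix_(a < 6, e < 6) G K a e.
have Munit : M \in unitmx.
  rewrite unitmxE unitfE (det_laplace 6 (G K)).
  (* The determinant is computed over the integers and carried to [K], where characteristic zero
     keeps it nonzero. *)
  have -> : laplace 6 (G K) = (intmul 1 \o int_of_Z) (laplace 6 (G Z)).
    rewrite laplace_morph; apply: eq_laplace => a e _ _.
    by rewrite /G rmorph_int.
  by rewrite /= intr_eq0 -(inj_eq (can_inj int_of_ZK)) in detB *.
pose W (k : nat) := if [pick F | code (val F) == k] is Some F then w F else 0.
pose b : 'cV[K]_6 := \col_a (scale (nth 0%N (codes B) a) * W (nth 0%N (codes B) a)).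
pose u (e : nat) := (invmx M *m b) (inord e) 0.
have uW k : k \in codes B -> (\sum_(e < 6) gradient K k e * u e) / scale k = W k.
  move=> kB; have k6 : (index k (codes B) < 6)%N by rewrite -B6 index_mem.
  have := congr1 (fun C : 'cV_6 => C (Ordinal k6) 0) (mulKVmx Munit b).
  rewrite !mxE /= nth_index // => Mb.
  apply: (@mulIf _ (scale k)) => //.
  rewrite divfK // mulrC -Mb.
  by apply: eq_bigr => e _; rewrite mxE /G /= nth_index // /u inord_val.
have [r rP] := fin_all_exists (fun F => heron_arc u (code_lt F)).
exists (fun t => edge_lengths (fun e => base_point e + t * u e)), r => t F FB.
rewrite !heron_map_code rP uW ?mem_codes //; congr (_ + t * (_ + _)).
rewrite /W; case: pickP => [F' /eqP/code_inj -> //|/(_ F)]; by rewrite eqxx.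
Qed.

Lemma coord_proj_code (B : {set face 3}) k : k \in codes B ->
  exists2 b : {F : face 3 | F \in B}, code (val (val b)) = k &
    forall v, coord_proj B (heron_map (edge_lengths v)) b = (heron_coords v)`_k.
Proof.
move=> /codesP[F FB ->]; exists (exist _ F FB) => // v.
by rewrite ffunE heron_map_code.
Qed.

Lemma polyfun_heron2 (I : finType) (f g h : {ffun I -> K} -> K) :
  polyfun f -> polyfun g -> polyfun h -> polyfun (fun x => heron2 (f x) (g x) (h x)).
Proof.
move=> pf pg ph.
by do ![apply: polyfunB|apply: polyfunM|apply: polyfunD|apply: polyfunX
       |apply: polyfun_const|done].
Qed.

(** The relation is Heron's formula; at the indicator of [d] it takes the value -1. *)
Lemma triangle_not_dominant (B : {set face 3}) a b c d :
  (forall v, let z := heron_coords v in z`_d = heron2 z`_a z`_b z`_c / 16) ->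
  uniq [:: a; b; c; d] -> all (mem (codes B)) [:: a; b; c; d] ->
  ~ dominant_on (heron_variety K 3) (coord_proj B).
Proof.
move=> rel; rewrite /= !inE !negb_or => /and4P[/and3P[_ _ ad] /andP[_ bd] cd _].
move=> /and5P[aB bB cB dB _].
have [a' a'E aE] := coord_proj_code aB; have [b' b'E bE] := coord_proj_code bB.
have [c' c'E cE] := coord_proj_code cB; have [d' d'E dE] := coord_proj_code dB.
apply: (heron_not_dominant
  (g := fun y => heron2 (y a') (y b') (y c') / 16 - y d')
  (y := [ffun F => (code (val (val F)) == d)%:R])).
- apply: polyfunB; last exact: polyfun_coord.
  apply: polyfunM; last exact: polyfun_const.
  by apply: polyfun_heron2; apply: polyfun_coord.
- by move=> x; have [v ->] := edge_lengths_surj x; rewrite aE bE cE dE rel subrr.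
rewrite !ffunE a'E b'E c'E d'E eqxx (negbTE ad) (negbTE bd) (negbTE cd).
have -> : heron2 (false%:R : K) false%:R false%:R = 0 by rewrite /heron2 /=; ring.
by rewrite mul0r sub0r oppr_eq0 pnatr_eq0.
Qed.

(* Each area formula is a monic quadratic equation in the squared length e of
   the common edge; the resultant of the two eliminates e. *)
Lemma two_triangles_not_dominant (B : {set face 3}) a b c d s t :
  (forall v, exists e, let z := heron_coords v in
     z`_s = heron2 z`_a z`_b e / 16 /\ z`_t = heron2 z`_c z`_d e / 16) ->
  uniq [:: a; b; c; d; s; t] -> all (mem (codes B)) [:: a; b; c; d; s; t] ->
  ~ dominant_on (heron_variety K 3) (coord_proj B).
Proof.
move=> rel /= + /andP[aB /and5P[bB cB dB sB /andP[tB _]]].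
rewrite !inE !negb_or => /and5P[/and5P[_ _ _ as_ _] /and4P[_ _ bs _]].
move=> /and3P[_ cs _] /andP[ds _] /andP[st _].
have [a' a'E aE] := coord_proj_code aB; have [b' b'E bE] := coord_proj_code bB.
have [c' c'E cE] := coord_proj_code cB; have [d' d'E dE] := coord_proj_code dB.
have [s' s'E sE] := coord_proj_code sB; have [t' t'E tE] := coord_proj_code tB.
(* With [e] the common edge, the two formulas read [e ^+ 2 + p * e + q = 0] and
   [e ^+ 2 + p' * e + q' = 0]; the last line is their resultant. *)
pose g (y : {ffun {F : face 3 | F \in B} -> K}) :=
  let p := - 2 * (y a' + y b') in let q := (y a' - y b') ^+ 2 + 16 * y s' in
  let p' := - 2 * (y c' + y d') in let q' := (y c' - y d') ^+ 2 + 16 * y t' in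
  (q' - q) ^+ 2 + (p - p') * (p * q' - p' * q).
apply: (heron_not_dominant (g := g) (y := [ffun F => (code (val (val F)) == s)%:R])).
- rewrite /g; by do ![apply: polyfunB|apply: polyfunM|apply: polyfunD|apply: polyfunX
       |apply: polyfun_const|apply: polyfun_coord].
- move=> x; have [v ->] := edge_lengths_surj x; have [e [sz tz]] := rel v.
  by rewrite /g aE bE cE dE sE tE sz tz /heron2; field.
(* At the indicator of [s] only [q = 16] survives, so the resultant is [16 ^+ 2]. *)
rewrite /g !ffunE a'E b'E c'E d'E s'E t'E eqxx.
rewrite (negbTE as_) (negbTE bs) (negbTE cs) (negbTE ds) [t == s]eq_sym (negbTE st).
rewrite [X in X != 0](_ : _ = (16 ^+ 2)%:R) ?pnatr_eq0 //=; ring.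
Qed.

End HeronCodes.

(** * The matroid of the third Heron variety *)

(** The translates of [C1] and [C2] in codes; in the second list the common edge 23, with code 3, is
    absent. *)
Definition circuit_codes : seq (seq nat) :=
  code_orbit [:: 0; 1; 3; 6] ++ code_orbit [:: 0; 1; 4; 5; 6; 9].

Definition has_circuit (ks : seq nat) : bool :=
  has (fun c => all (mem ks) c) circuit_codes.

Definition hexads : seq (seq nat) :=
  [seq ks <- sublists (iota 0 11) | size ks == 6].

Definition free_hexads : seq (seq nat) := [seq ks <- hexads | ~~ has_circuit ks].

Definition bound_hexads : seq (seq nat) := [seq ks <- hexads | has_circuit ks].

Lemma codes_sublist A : codes A \in sublists (iota 0 11).
Proof. exact: filter_sublists. Qed.

Lemma mem_hexads A : (codes A \in hexads) = (#|A| == 6%N).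
Proof. by rewrite mem_filter codes_sublist andbT size_codes. Qed.

Lemma mem_free_hexads A :
  (codes A \in free_hexads) = ~~ has_circuit (codes A) && (#|A| == 6%N).
Proof. by rewrite /free_hexads mem_filter mem_hexads. Qed.

Lemma mem_bound_hexads A :
  (codes A \in bound_hexads) = has_circuit (codes A) && (#|A| == 6%N).
Proof. by rewrite /bound_hexads mem_filter mem_hexads. Qed.

Lemma free_hexads_sublists h : h \in free_hexads -> h \in sublists (iota 0 11).
Proof.
rewrite /free_hexads mem_filter => /andP[_].
by rewrite /hexads mem_filter => /andP[].
Qed.

Lemma has_circuitP ks : reflect (exists2 c, c \in circuit_codes & all (mem ks) c)
  (has_circuit ks).
Proof. exact: hasP. Qed.

(** There are four triangles with their edges, then six pairs of triangles in the order of the code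
    of their common edge. *)
Lemma circuit_codesP (c : seq nat) : c \in circuit_codes ->
  c \in [:: [:: 0; 1; 3; 6]; [:: 0; 2; 4; 7]; [:: 1; 2; 5; 8]; [:: 3; 4; 5; 9];
    [:: 1; 2; 3; 4; 6; 7]; [:: 0; 2; 3; 5; 6; 8]; [:: 0; 1; 4; 5; 7; 8];
    [:: 0; 1; 4; 5; 6; 9]; [:: 0; 2; 3; 5; 7; 9]; [:: 1; 2; 3; 4; 8; 9]]%N.
Proof. by move: c; apply/allP; vm_compute. Qed.

Lemma circuit_codes_sublists c : c \in circuit_codes -> c \in sublists (iota 0 11).
Proof. by move: c; apply/allP; vm_compute. Qed.

(** This gives minimality: no proper subset of a translate contains another one. *)
Lemma circuit_codes_antichain b c : b \in circuit_codes -> c \in circuit_codes ->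
  all (mem c) b -> b = c.
Proof.
have /allP anti :
  all (fun b => all (fun c => all (mem c) b ==> (b == c)) circuit_codes)
    circuit_codes by vm_compute.
by move=> /anti/allP anti_b /anti_b /implyP bc /bc /eqP.
Qed.

Lemma free_hexads_det ks : ks \in free_hexads ->
  laplace 6 (fun a e => gradient Z (nth 0%N ks a) e) != 0.
Proof. by move: ks; apply/allP; vm_compute. Qed.

(** Independence of a small set means lying in a basis; the exhaustive search finds a circuit-free
    hexad around every circuit-free set. *)
Lemma free_extension ks : ks \in sublists (iota 0 11) -> (size ks <= 6)%N ->
  ~~ has_circuit ks -> exists2 h, h \in free_hexads & all (mem h) ks.
Proof.
move=> ksub ks6 kfree; apply/hasP; move: ks ksub ks6 kfree.
have /allP ext : all (fun ks => (size ks <= 6)%N ==> ~~ has_circuit ks ==>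
  has (fun h => all (mem h) ks) free_hexads) (sublists (iota 0 11)) by vm_compute.
by move=> ks /ext /implyP ext6 /ext6 /implyP.
Qed.

Section HeronMatroid.
Variable K : numFieldType.
Let X3 := heron_variety K 3.

Lemma card_edge3 : #|{: edge 3}| = 6%N.
Proof.
rewrite card_sig (@eq_card _ _ (mem [set e : {set 'I_4} | #|e| == 2%N])).
  by rewrite card_draws card_ord.
by move=> e; rewrite !inE.
Qed.

Lemma free_hexad_basis (B : {set face 3}) :
  codes B \in free_hexads -> matroid_basis X3 B.
Proof.
move=> freeB; have := freeB; rewrite mem_free_hexads => /andP[_ /eqP B6]; split.
  by apply: heron_generically_finite; rewrite card_edge3 B6.
by apply: heron_codes_dominant; [rewrite size_codes|exact: free_hexads_det].
Qed.

Lemma has_circuit_not_dominant (B : {set face 3}) : has_circuit (codes B) ->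
  ~ dominant_on X3 (coord_proj B).
Proof.
move=> /has_circuitP[c /circuit_codesP cC /allP cB].
have {cB} memB s : all (mem c) s -> all (mem (codes B)) s.
  by move=> /allP sc; apply/allP => k /sc; apply: cB.
move: cC; rewrite !inE; do ![case/orP]; move=> /eqP cE; rewrite {}cE in memB.
- by apply: (@triangle_not_dominant _ B 0 1 3 6) => //; apply: memB.
- by apply: (@triangle_not_dominant _ B 0 2 4 7) => //; apply: memB.
- by apply: (@triangle_not_dominant _ B 1 2 5 8) => //; apply: memB.
- by apply: (@triangle_not_dominant _ B 3 4 5 9) => //; apply: memB.
(* From here on the witness is the squared length of the edge shared by the two triangles. *)
- apply: (@two_triangles_not_dominant _ B 1 3 2 4 6 7); rewrite ?memB // => v.
  by exists (v 0%N); rewrite /= /heron2; split; ring.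
- apply: (@two_triangles_not_dominant _ B 0 3 2 5 6 8); rewrite ?memB // => v.
  by exists (v 1%N); rewrite /= /heron2; split; ring.
- apply: (@two_triangles_not_dominant _ B 0 4 1 5 7 8); rewrite ?memB // => v.
  by exists (v 2%N); rewrite /= /heron2; split; ring.
- apply: (@two_triangles_not_dominant _ B 0 1 4 5 6 9); rewrite ?memB // => v.
  by exists (v 3%N); rewrite /= /heron2; split; ring.
- apply: (@two_triangles_not_dominant _ B 0 2 3 5 7 9); rewrite ?memB // => v.
  by exists (v 4%N); rewrite /= /heron2; split; ring.
apply: (@two_triangles_not_dominant _ B 1 2 3 4 8 9); rewrite ?memB // => v.
by exists (v 5%N); rewrite /= /heron2; split; ring.
Qed.

Lemma matroid_basisE (B : {set face 3}) : #|B| = 6%N ->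
  matroid_basis X3 B <-> ~~ has_circuit (codes B).
Proof.
move=> B6; split=> [[_ dom]|freeB]; first by apply/negP => /has_circuit_not_dominant.
by apply: free_hexad_basis; rewrite mem_free_hexads freeB B6.
Qed.

(** A set without circuit extends to a free hexad, which is a basis. Conversely, any set containing
    a circuit has a projection that is not dominant, so no basis contains it. *)
Lemma matroid_dependentE (A : {set face 3}) : (#|A| <= 6)%N ->
  matroid_dependent X3 A <-> has_circuit (codes A).
Proof.
move=> A6; split=> [depA|/has_circuitP[c cC cA] [B [_ dom] AB]].
  apply/negPn/negP => freeA; apply: depA.
  have [|h hfree hA] := free_extension (codes_sublist A) _ freeA.
    by rewrite size_codes.
  have hE := codes_set_of_codesP (free_hexads_sublists hfree).
  exists (set_of_codes h); first by apply: free_hexad_basis; rewrite hE.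
  by rewrite codes_sub hE.
apply: (has_circuit_not_dominant _ dom).
apply/has_circuitP; exists c; first exact: cC.
by move: AB; rewrite codes_sub => /allP AB; apply/allP => k /(allP cA)/AB.
Qed.

Lemma matroid_circuitE (A : {set face 3}) : (#|A| <= 6)%N ->
  matroid_circuit X3 A <-> codes A \in circuit_codes.
Proof.
move=> A6; split=> [[/(matroid_dependentE A6)/has_circuitP[c cC cA] minA]|AC].
  (* The translate inside [A] is itself dependent, so minimality of [A] forces equality. *)
  have cE := codes_set_of_codesP (circuit_codes_sublists cC).
  have cA' : set_of_codes c \subset A by rewrite codes_sub cE.
  have [<-|ncA] := eqVneq (set_of_codes c) A; first by rewrite cE.
  have pcA : set_of_codes c \proper A by rewrite finset.properEneq ncA.
  case: (minA _ pcA); apply/matroid_dependentE.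
    exact: leq_trans (subset_leq_card cA') A6.
  apply/has_circuitP; exists c; first exact: cC.
  by rewrite cE; apply/allP => k.
split.
  apply/(matroid_dependentE A6)/has_circuitP.
  by exists (codes A); [exact: AC|apply/allP => k].
move=> D /andP[DA /negP AD] /matroid_dependentE.
move=> /(_ (leq_trans (subset_leq_card DA) A6)) /has_circuitP[c cC cD].
have cA : all (mem (codes A)) c.
  by move: DA; rewrite codes_sub => /allP DA; apply/allP => k /(allP cD)/DA.
by apply: AD; rewrite codes_sub -(circuit_codes_antichain cC AC cA).
Qed.

End HeronMatroid.

(** * Orbit representatives *)

Lemma codes_map_faces L :
  map codes (map faces L) = [seq normalize (map digits_code ds) | ds <- L].
Proof. by rewrite -map_comp; apply: eq_map => ds; apply: codes_faces. Qed.

Definition orbits_distinct (s : seq (seq nat)) : bool :=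
  pairwise (fun a b => a \notin code_orbit b) s.

Lemma uniq_face_orbits (s : seq {set face 3}) : orbits_distinct (map codes s) ->
  uniq [seq face_orbit B | B <- s].
Proof.
rewrite /orbits_distinct uniq_pairwise !pairwise_map.
by apply: sub_pairwise => A B; rewrite /= face_orbit_eq mem_face_orbit.
Qed.

Definition code_orbits (s : seq (seq nat)) : seq (seq nat) :=
  flatten (map code_orbit s).

Lemma face_orbitsP (s : seq {set face 3}) (A : {set face 3}) :
  reflect (exists2 B, B \in s & face_orbit A = face_orbit B)
    (codes A \in code_orbits (map codes s)).
Proof.
apply: (iffP flatten_mapP) => [[_ /mapP[B Bs ->] AB]|[B Bs /eqP]].
  by exists B => //; apply/eqP; rewrite face_orbit_eq mem_face_orbit.
by rewrite face_orbit_eq mem_face_orbit => AB; exists (codes B); rewrite ?map_f.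
Qed.

Lemma face_orbit_refl (A : {set face 3}) : A \in face_orbit A.
Proof. exact: orbit_refl. Qed.

Lemma orbit_representatives_codes (P : {set face 3} -> Prop) s :
  orbits_distinct (map codes s) ->
  (forall A, P A <-> codes A \in code_orbits (map codes s)) ->
  orbit_representatives P s.
Proof.
move=> /uniq_face_orbits s_uniq PE; split=> // O.
split=> [/mapP[B Bs ->]|[[A ->] PA]].
  split=> [|A]; first by exists B.
  by rewrite -face_orbit_eq => /eqP AB; apply/PE/face_orbitsP; exists B.
have /PE/face_orbitsP[B Bs ->] := PA A (face_orbit_refl A).
exact: map_f.
Qed.

Lemma card_face_orbits s (k : nat) : orbits_distinct (map codes s) ->
  (forall A : {set face 3}, (#|A| == k) = (codes A \in code_orbits (map codes s))) ->
  #|[set face_orbit B | B : {set face 3} & #|B| == k]| = size s.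
Proof.
move=> /uniq_face_orbits s_uniq kE.
rewrite -(size_map (fun B => face_orbit B) s) -(card_uniqP s_uniq).
apply: eq_card => O; apply/imsetP/mapP => [[A]|[B Bs ->]].
  by rewrite inE kE => /face_orbitsP[B Bs ->] ->; exists B.
by exists B => //; rewrite inE kE; apply/face_orbitsP; exists B.
Qed.

Lemma eq_mem_all (T : eqType) (s t : seq T) :
  all (mem s) t && all (mem t) s -> s =i t.
Proof. by case/andP => /allP ts /allP st x; apply/idP/idP => [/st|/ts]. Qed.

Lemma basis_orbits : code_orbits (map codes basis_reps) =i free_hexads.
Proof. by apply: eq_mem_all; rewrite codes_map_faces; vm_compute. Qed.

Lemma nonbasis_orbits : code_orbits (map codes nonbasis_reps) =i bound_hexads.
Proof. by apply: eq_mem_all; rewrite codes_map_faces; vm_compute. Qed.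

Lemma circuit_orbits : code_orbits (map codes circuit_reps) =i circuit_codes.
Proof. by apply: eq_mem_all; rewrite codes_map_faces; vm_compute. Qed.

(** Bases and non-bases are tested in one list, since the count of 35 needs all their orbits to be
    distinct. *)
Lemma reps_distinct :
  orbits_distinct (map codes (basis_reps ++ nonbasis_reps)) /\
  orbits_distinct (map codes circuit_reps).
Proof. by rewrite map_cat !codes_map_faces; split; vm_compute. Qed.

Theorem theorem4p3 (R : realType) :
  let X3 := heron_variety R[i] 3 in
  [/\ #|[set face_orbit B | B : {set face 3} & #|B| == 6%N]| = 35%N,
      size basis_reps = 28%N /\
      orbit_representatives
        (fun B => #|B| = 6%N /\ matroid_basis X3 B) basis_reps,
      size nonbasis_reps = 7%N /\
      orbit_representatives
        (fun B => #|B| = 6%N /\ ~ matroid_basis X3 B) nonbasis_reps &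
      orbit_representatives
        (fun B => (#|B| <= 6)%N /\ matroid_circuit X3 B) circuit_reps].
Proof.
have [distinct distinct_circuits] := reps_distinct.
have [distinct_bases distinct_nonbases] :
    orbits_distinct (map codes basis_reps) /\
    orbits_distinct (map codes nonbasis_reps).
  move: distinct; rewrite /orbits_distinct map_cat pairwise_cat.
  by case/and3P.
move=> X3; split.
(* Every hexad is free or bound, so the two lists together represent all orbits, 28 + 7 in
   number. *)
- rewrite (card_face_orbits distinct) // => A.
  rewrite map_cat /code_orbits map_cat flatten_cat mem_cat.
  rewrite basis_orbits nonbasis_orbits mem_free_hexads mem_bound_hexads.
  by case: has_circuit; rewrite ?orbF.
- split=> //; apply: orbit_representatives_codes => // A.
  rewrite basis_orbits mem_free_hexads; split.
    by move=> [A6 /(matroid_basisE R[i] A6) ->]; rewrite A6.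
  by move=> /andP[freeA /eqP A6]; split=> //; apply/matroid_basisE.
- split=> //; apply: orbit_representatives_codes => // A.
  rewrite nonbasis_orbits mem_bound_hexads; split.
    move=> [A6 nbA]; rewrite A6 andbT; apply/negPn/negP => freeA.
    by apply/nbA/(matroid_basisE R[i] A6).
  move=> /andP[circA /eqP A6]; split=> //.
  by move=> /(matroid_basisE R[i] A6); rewrite circA.
apply: orbit_representatives_codes => // A; rewrite circuit_orbits; split.
  by move=> [A6 /(matroid_circuitE R[i] A6)].
move=> AC; have A6 : (#|A| <= 6)%N.
  by rewrite -size_codes; move: (codes A) AC; apply/allP; vm_compute.
by split=> //; apply/matroid_circuitE.
Qed.
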